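(* For every integer $n\geq 5$, the Kneser graph $KG_{n,2}$ has no quantum symmetry.
   Context: The Kneser graph $KG_{n,2}$ has as vertices the $2$-element subsets of $\{1,\dots,n\}$; two vertices are adjacent iff they are disjoint. Quantum automorphism group (Banica). Let $\Gamma$ be a finite graph with vertex set $V$ and adjacency matrix $A$. Its quantum automorphism group is the compact quantum group whose function algebra is the universal unital $C^*$-algebra $C(\mathrm{Qut}(\Gamma))$ generated by elements $u_{xy}$ ($x,y\in V$) subject to: each $u_{xy}$ is a projection ($u_{xy}=u_{xy}^*=u_{xy}^2$), $\sum_{y}u_{xy}=1=\sum_{y}u_{yx}$ for all $x\in V$, and $Au=uA$ where $u=(u_{xy})_{x,y\in V}$. The graph $\Gamma$ has no quantum symmetry if its quantum automorphism group coincides with its classical automorphism group $\mathrm{Aut}(\Gamma)$, i.e. if the canonical surjection $C(\mathrm{Qut}(\Gamma))\to C(\mathrm{Aut}(\Gamma))$, $u_{xy}\mapsto (g\mapsto\delta_{x,g(y)})$, is an isomorphism; equivalently, if $C(\mathrm{Qut}(\Gamma))$ is commutative. *)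

(* Defs.v *)
From HB Require Import structures.
From mathcomp Require Import all_boot all_order all_algebra all_fingroup.
From mathcomp Require Import complex.
From mathcomp Require Import all_classical all_reals.

Set Implicit Arguments.
Unset Strict Implicit.
Unset Printing Implicit Defensive.

Import Order.TTheory GRing.Theory Num.Theory.

Local Open Scope ring_scope.

(* Unital *-algebras and unital C*-algebras over the complex numbers R[i].
   An algType is a nonzero ring, so the zero algebra is not an instance.
   This does not affect the universal property in [isCQut]: every unital
   *-algebra has exactly one unital *-homomorphism to the zero algebra. *)

HB.mixin Record Algebra_hasStar (R : realType) A of GRing.Algebra R[i] A := {
  star : A -> A;
  starD : forall x y : A, star (x + y) = star x + star y;
  starZ : forall (a : R[i]) (x : A), star (a *: x) = a^* *: star x;
  starM : forall x y : A, star (x * y) = star y * star x;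
  starK : forall x : A, star (star x) = x
}.

#[short(type="starAlgType")]
HB.structure Definition StarAlgebra (R : realType) :=
  {A of Algebra_hasStar R A & GRing.Algebra R[i] A}.

(* The norm is a field of its own because a Hierarchy Builder join of algType
   with completeNormedModType is rejected: numDomainType already joins rings
   with normed modules. *)
HB.mixin Record StarAlgebra_isCStar (R : realType) A of StarAlgebra R A := {
  cnorm : A -> R;
  cnorm0_eq0 : forall x : A, cnorm x = 0 -> x = 0;
  cnormD : forall x y : A, cnorm (x + y) <= cnorm x + cnorm y;
  cnormZ : forall (a : R[i]) (x : A), cnorm (a *: x) = ComplexField.Normc.normc a * cnorm x;
  cnormM : forall x y : A, cnorm (x * y) <= cnorm x * cnorm y;
  cnorm_star_mul : forall x : A, cnorm (star x * x) = cnorm x ^+ 2;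
  cnorm_complete : forall s : nat -> A,
    (forall e : R, 0 < e -> exists N : nat,
       forall m n, (N <= m)%N -> (N <= n)%N -> cnorm (s m - s n) < e) ->
    exists l : A, forall e : R, 0 < e -> exists N : nat,
      forall n, (N <= n)%N -> cnorm (s n - l) < e
}.

#[short(type="cstarAlgType")]
HB.structure Definition CStarAlgebra (R : realType) :=
  {A of StarAlgebra R A & StarAlgebra_isCStar R A}.

(* Between C*-algebras such maps are automatically contractive, and the
   bijective ones are isometric. *)
Record starHom (R : realType) (A B : starAlgType R) := StarHom {
  starHom_fun :> {lrmorphism A -> B};
  starHomP : forall x : A, starHom_fun (star x) = star (starHom_fun x)
}.

Record sgraph := SGraph {
  vertex :> finType;
  edge : rel vertex;
  edge_sym : symmetric edge;
  edge_irrefl : irreflexive edge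
}.

Definition adjmx (R : realType) (G : sgraph) (x y : G) : R[i] :=
  (edge x y)%:R.

Definition KG2_vertex (n : nat) : finType := {A : {set 'I_n} | #|A| == 2}.

Definition KG2_edge (n : nat) : rel (KG2_vertex n) :=
  fun A B => [disjoint val A & val B].

Fact KG2_sym n : symmetric (@KG2_edge n).
Proof. by move=> A B; rewrite /KG2_edge disjoint_sym. Qed.

Fact KG2_irrefl n : irreflexive (@KG2_edge n).
Proof.
move=> [A /= cA]; rewrite /KG2_edge /= -finset.setI_eq0 finset.setIid.
by apply: contraTF cA => /eqP ->; rewrite cards0.
Qed.

Definition KG2 (n : nat) : sgraph := SGraph (@KG2_sym n) (@KG2_irrefl n).

(* The defining relations of C(Qut(G)); the last one is Au = uA entrywise. *)
Record qut_relations (R : realType) (G : sgraph) (A : starAlgType R)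
    (u : G -> G -> A) : Prop := QutRelations {
  qut_star : forall x y, star (u x y) = u x y;
  qut_idem : forall x y, u x y * u x y = u x y;
  qut_row : forall x, \sum_y u x y = 1;
  qut_col : forall x, \sum_y u y x = 1;
  qut_adj : forall x y,
    \sum_z adjmx R x z *: u z y = \sum_z adjmx R z y *: u x z
}.

(* [A], with generators [u], is the universal unital C*-algebra C(Qut(G)). *)
Record isCQut (R : realType) (G : sgraph) (A : cstarAlgType R)
    (u : G -> G -> A) : Prop := IsCQut {
  CQut_rel : qut_relations u;
  CQut_lift : forall (B : cstarAlgType R) (v : G -> G -> B),
    qut_relations v ->
    exists f : starHom A B, forall x y, f (u x y) = v x y;
  CQut_uniq : forall (B : cstarAlgType R) (f g : starHom A B),
    (forall x y, f (u x y) = g (u x y)) -> f =1 g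
}.

Definition is_graph_aut (G : sgraph) (g : {perm G}) : bool :=
  [forall x, forall y, edge (g x) (g y) == edge x y].

Definition graph_aut (G : sgraph) := {g : {perm G} | is_graph_aut g}.

Fact is_graph_aut1 (G : sgraph) : is_graph_aut (1%g : {perm G}).
Proof. by apply/forallP => x; apply/forallP => y; rewrite !perm1. Qed.

HB.instance Definition _ (G : sgraph) := Choice.on (graph_aut G).
HB.instance Definition _ (G : sgraph) :=
  isPointed.Build (graph_aut G) (exist _ (1%g : {perm G}) (is_graph_aut1 G)).

(* C(Aut(G)): Aut(G) is finite, hence discrete, so every function on it is
   continuous. *)
Definition CAut (R : realType) (G : sgraph) := graph_aut G -> R[i].

Section CAutAlgebra.
Context (R : realType) (G : sgraph).

HB.instance Definition _ := GRing.NzRing.copy (CAut R G) (graph_aut G -> R[i]).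
HB.instance Definition _ := GRing.Lmodule.copy (CAut R G) (graph_aut G -> R[i]).

Fact CAut_scalerAl (a : R[i]) (f h : CAut R G) : a *: (f * h) = a *: f * h.
Proof. by apply/funext => g; exact: mulrA. Qed.

HB.instance Definition _ :=
  GRing.Lmodule_isLalgebra.Build R[i] (CAut R G) CAut_scalerAl.

Fact CAut_scalerAr (a : R[i]) (f h : CAut R G) : a *: (f * h) = f * (a *: h).
Proof. by apply/funext => g; exact: mulrCA. Qed.

HB.instance Definition _ :=
  GRing.Lalgebra_isAlgebra.Build R[i] (CAut R G) CAut_scalerAr.

Definition CAut_star (f : CAut R G) : CAut R G := fun g => (f g)^*.

Fact CAut_starD f h : CAut_star (f + h) = CAut_star f + CAut_star h.
Proof. by apply/funext => g; exact: rmorphD. Qed.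

Fact CAut_starZ (a : R[i]) f : CAut_star (a *: f) = a^* *: CAut_star f.
Proof. by apply/funext => g; exact: rmorphM. Qed.

Fact CAut_starM f h : CAut_star (f * h) = CAut_star h * CAut_star f.
Proof. by apply/funext => g; rewrite mulrC; exact: rmorphM. Qed.

Fact CAut_starK f : CAut_star (CAut_star f) = f.
Proof. by apply/funext => g; exact: conjCK. Qed.

HB.instance Definition _ := Algebra_hasStar.Build R (CAut R G)
  CAut_starD CAut_starZ CAut_starM CAut_starK.

End CAutAlgebra.

Definition CAut_gen (R : realType) (G : sgraph) (x y : G) : CAut R G :=
  fun g => (x == val g y)%:R.

(* The first conjunct says that C(Qut(G)) exists, so that the second one,
   which ranges over all its (mutually isomorphic) models, is not vacuous. *)
Definition no_quantum_symmetry (R : realType) (G : sgraph) : Prop :=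
  (exists (A : cstarAlgType R) (u : G -> G -> A), isCQut u) /\
  forall (A : cstarAlgType R) (u : G -> G -> A), isCQut u ->
    exists p : starHom A (CAut R G),
      (forall x y, p (u x y) = CAut_gen R x y) /\ bijective p.

(* Main.v *)
Require Import Defs.
From HB Require Import structures.
From mathcomp Require Import all_boot ssrAC all_order all_algebra all_fingroup.
From mathcomp Require Import complex lra.
From mathcomp Require Import boolp all_reals.

(* Write x # z when the pairs x and z share exactly one point.

   In a C*-algebra, projections summing to 1 are orthogonal: if e is one of them
   and p another, a multiple of e p e can be both added to and subtracted from e
   without leaving the unit ball, and the unit of a corner is an extreme point of
   its unit ball. Hence u_xy u_zw = 0 unless (x, z) and (y, w) are in the same
   relation (equal, disjoint, or #).

   Two pairs x # z form a triangle with a unique t (their symmetric difference),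
   and triangles are told apart from three-edge stars by the number of pairs
   disjoint from all three, 'C(n - 3, 2) against 'C(n - 4, 2); these differ
   exactly when n >= 5. Counting such pairs with the magic unitary gives
   u_xy u_zw = u_xy u_ts u_zw for triangles x, t, z and y, s, w, and three
   projections pairwise related this way commute. This settles x # z.
   If x and z are disjoint and y <> p are both disjoint from w, some q is # to y
   and w but disjoint from p; inserting the column q and using the previous case
   gives u_xy u_zw u_xp = 0, so that u_xy u_zw = u_xy u_zw u_xy is self-adjoint.

   Finally, commuting generators factor through C(Aut), which is therefore the
   universal C*-algebra. *)

Set Implicit Arguments.
Unset Strict Implicit.
Unset Printing Implicit Defensive.

Import Order.TTheory GRing.Theory Num.Theory.

Local Open Scope ring_scope.
Local Open Scope complex_scope.
Local Notation normc := ComplexField.Normc.normc.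

(** * Orthogonality of projections summing to 1 *)

Section CStar.
Context (R : realType) (B : cstarAlgType R).
Implicit Types x y e p : B.

Lemma normc_real (a : R) : normc a%:C = `|a|.
Proof. by rewrite /normc /= expr0n addr0 sqrtr_sqr. Qed.

Lemma cnormZr (a : R) x : cnorm (a%:C *: x) = `|a| * cnorm x.
Proof. by rewrite cnormZ normc_real. Qed.

Lemma star0 : star (0 : B) = 0.
Proof. by apply: (@addrI _ (star 0)); rewrite -starD !addr0. Qed.

Lemma starN x : star (- x) = - star x.
Proof. by apply: (@addrI _ (star x)); rewrite -starD !subrr star0. Qed.

Lemma star1 : star (1 : B) = 1.
Proof. by rewrite -[LHS](mulr1) -[X in _ * X]starK -starM mulr1 starK. Qed.

Lemma cnorm0 : cnorm (0 : B) = 0.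
Proof. by rewrite -(scale0r 0) cnormZ ComplexField.Normc.normc0 mul0r. Qed.

Lemma cnormN x : cnorm (- x) = cnorm x.
Proof.
by rewrite -scaleN1r -(rmorph1 (real_complex R)) -rmorphN cnormZr normrN1 mul1r.
Qed.

Lemma cnorm_ge0 x : 0 <= cnorm x.
Proof. by have := cnormD x (- x); rewrite subrr cnorm0 cnormN; lra. Qed.

Lemma cnorm_sum (I : Type) (r : seq I) (P : pred I) (F : I -> B) :
  cnorm (\sum_(i <- r | P i) F i) <= \sum_(i <- r | P i) cnorm (F i).
Proof.
elim/big_rec2: _ => [|i a b _ h]; first by rewrite cnorm0.
by apply: le_trans (cnormD _ _) _; rewrite lerD2l.
Qed.

Definition projection p := star p = p /\ p * p = p.

Lemma projectionC p : projection p -> projection (1 - p).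
Proof.
move=> [sp pp]; split; first by rewrite starD starN star1 sp.
by rewrite mulrBl mul1r mulrBr mulr1 pp subrr subr0.
Qed.

Lemma cnorm_projection p : projection p -> cnorm p <= 1.
Proof.
move=> [sp pp]; have := cnorm_star_mul p; rewrite sp pp.
have := cnorm_ge0 p; nra.
Qed.

(* For a = 0 and M = s ^ 2 this bounds x by 1 / s. The right-hand side is
   (E (a + S_M) ^ 2 + s ^ 2) / 2s for a simple random walk S_M: one step
   averages over e + x and e - x. *)
Lemma cnorm_walk e x (s : R) :
  0 < s -> e * e = e -> e * x = x -> x * e = x -> cnorm e <= 1 ->
  cnorm (e + x) <= 1 -> cnorm (e - x) <= 1 ->
  forall (M : nat) (a : R),
    cnorm (a%:C *: e + x *+ M) <= (a ^+ 2 + M%:R + s ^+ 2) / (s *+ 2).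
Proof.
move=> s0 ee ex xe ne nP nN; elim=> [|M IH] a.
  rewrite addr0 cnormZr addr0 ler_pdivlMr; last by rewrite mulr2n addr_gt0.
  have : `|a| * cnorm e <= `|a| by rewrite ler_piMr.
  have := sqr_ge0 (`|a| - s); rewrite -(real_normK (num_real a)).
  have := normr_ge0 a; have := cnorm_ge0 e; nra.
(* As [e] acts as a unit on [x], averaging the two walk steps leaves one more copy of [x], and the
   terms in [x * x] cancel. *)
have -> : a%:C *: e + x *+ M.+1 = 2^-1%:C *:
   ((e + x) * ((a + 1)%:C *: e + x *+ M) + (e - x) * ((a - 1)%:C *: e + x *+ M)).
  rewrite !mulrDl !mulrDr !mulNr -!scalerAr ee xe !mulrnAr ex.
  rewrite !rmorphD rmorphN rmorph1.
  rewrite !scalerDl !scaleNr !scale1r mulrSr.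
  set w := _ *: x; set v := _ *: e; set u := x *+ M; set z := x * x *+ M.
  have -> : v + e + u + (w + x + z) + (v - e + u + (- (w - x) - z)) = 2%:R *: (v + (u + x)).
    rewrite opprB !addrA scaler_nat mulr2n.
    rewrite [LHS](ACl ((1*3*5)*(7*9*10)*(2*8)*(4*11)*(6*12))%AC) /=.
    by rewrite !subrr !addr0 !addrA.
  rewrite scalerA -(rmorph_nat (real_complex R)) -rmorphM mulVf ?pnatr_eq0 //.
  by rewrite rmorph1 scale1r.
rewrite cnormZr gtr0_norm ?invr_gt0 //.
have h (u v : B) : cnorm u <= 1 -> cnorm (u * v) <= cnorm v.
  by move=> nu; apply: le_trans (cnormM _ _) _; rewrite ler_piMl ?cnorm_ge0.
set v1 := (a + 1)%:C *: e + x *+ M; set v2 := (a - 1)%:C *: e + x *+ M.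
have h1 : cnorm ((e + x) * v1 + (e - x) * v2) <= cnorm v1 + cnorm v2.
  by apply: le_trans (cnormD _ _) _; apply: lerD; apply: h.
have := IH (a + 1); have := IH (a - 1); rewrite -/v1 -/v2.
have s2 : 0 < s *+ 2 by rewrite mulr2n addr_gt0.
rewrite !ler_pdivlMr // -[M.+1%:R]natr1 => h2 h3.
have := ler_wpM2r (ltW s2) h1; rewrite [X in _ <= X -> _]mulrDl; lra.
Qed.

(** Taking [a = 0], [M = k ^ 2] and [s = k] in [cnorm_walk] bounds the norm of [x *+ k ^ 2] by [k].
    This fails for a nonzero [x] as soon as [k] exceeds the inverse of its norm. *)
Lemma idem_extreme e x :
  e * e = e -> e * x = x -> x * e = x -> cnorm e <= 1 ->
  cnorm (e + x) <= 1 -> cnorm (e - x) <= 1 -> x = 0.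
Proof.
move=> ee ex xe ne nP nN; apply: cnorm0_eq0; apply/eqP.
rewrite eq_le cnorm_ge0 andbT leNgt; apply/negP => x0.
pose k := (Num.trunc (cnorm x)^-1).+1.
have k0 : (0 : R) < k%:R by rewrite ltr0n.
have hk : (cnorm x)^-1 < k%:R by exact: truncnS_gt.
have := cnorm_walk k0 ee ex xe ne nP nN (k ^ 2) 0.
rewrite rmorph0 scale0r add0r expr0n add0r natrX.
have -> : x *+ (k ^ 2) = (k%:R ^+ 2)%:C *: x.
  by rewrite -natrX rmorph_nat scaler_nat.
rewrite cnormZr ger0_norm ?sqr_ge0 // ler_pdivlMr; last by rewrite mulr2n addr_gt0.
have : 1 < k%:R * cnorm x by rewrite -ltr_pdivrMr // mul1r.
move: k0 x0; set t := k%:R; set c := cnorm x => t0 c0 tc h.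
have : t * 1 < t * (t * c) by rewrite ltr_pM2l.
nra.
Qed.

End CStar.

Section Orthogonality.
Context (R : realType) (B : cstarAlgType R).
Implicit Types x y e p : B.

Lemma star_mul_eq0 x : star x * x = 0 -> x = 0.
Proof.
move=> h; apply: cnorm0_eq0; apply/eqP; move: (cnorm_star_mul x).
by rewrite h cnorm0 => /esym/eqP; rewrite expf_eq0.
Qed.

Lemma cnorm_mean (I : finType) (P : pred I) (F : I -> B) :
  (0 < #|P|)%N -> (forall i, P i -> cnorm (F i) <= 1) ->
  cnorm ((#|P|%:R^-1)%:C *: \sum_(i | P i) F i) <= 1.
Proof.
move=> P0 hF; rewrite cnormZr gtr0_norm ?invr_gt0 ?ltr0n //.
rewrite mulrC ler_pdivrMr ?ltr0n // mul1r; apply: le_trans (cnorm_sum _ _ _) _.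
by rewrite -sum1_card natr_sum; apply: ler_sum.
Qed.

Lemma projections_orthogonal (I : finType) (p : I -> B) :
  (forall i, projection (p i)) -> \sum_i p i = 1 ->
  forall i j, i != j -> p i * p j = 0.
Proof.
move=> pP p1 i j ij; pose e := p i; pose r k := e * p k * e.
have [se ee] := pP i; have ne := cnorm_projection (pP i).
have nr k : cnorm (e - r k) <= 1.
  have -> : e - r k = e * (1 - p k) * e by rewrite mulrBr mulr1 mulrBl ee.
  have h := cnorm_projection (projectionC (pP k)).
  rewrite (le_trans (cnormM _ _)) // mulr_ile1 ?cnorm_ge0 //.
  by rewrite (le_trans (cnormM _ _)) // mulr_ile1 ?cnorm_ge0.
(* Compressing the sum of all [p k] by [e] gives [e], and the term [k = i] is already [e]. *)
have r0 : \sum_(k | k != i) r k = 0.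
  have : \sum_k r k = e by rewrite -mulr_suml -mulr_sumr p1 mulr1.
  rewrite (bigD1 i) //= {1}/r ee ee => h.
  by apply: (@addrI _ e); rewrite h addr0.
have ji : j != i by rewrite eq_sym.
pose M := #|predC1 i|.
have M0 : (0 < M)%N by apply/card_gt0P; exists j.
have MR : (M%:R : R) != 0 by rewrite pnatr_eq0 -lt0n.
have scM (y : B) : (M%:R^-1)%:C *: (y *+ M) = y.
  by rewrite -scaler_nat scalerA -(rmorph_nat (real_complex R)) -rmorphM mulVf // rmorph1 scale1r.
(* The factor [1 / M] makes [e + x] and [e - x] means of [M] elements of the unit ball. For [e + x],
   [r0] rewrites [r j] as minus the sum of the other [r k]. *)
pose x := (M%:R^-1)%:C *: r j.
have sumE : \sum_(k | k != i) e = e *+ M by rewrite sumr_const.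
have : x = 0.
  apply: (@idem_extreme _ _ e) => //.
  - by rewrite /x -scalerAr /r !mulrA ee.
  - by rewrite /x -scalerAl /r -!mulrA ee.
  - have -> : e + x = (M%:R^-1)%:C *: \sum_(k | k != i) (if k == j then e else e - r k).
      rewrite -[X in X + _]scM -scalerDr; congr (_ *: _).
      rewrite -sumE (bigD1 j) //= [RHS](bigD1 j) //= eqxx.
      rewrite [in RHS](eq_bigr (fun k => e - r k)); last by move=> k /andP[_ /negbTE->].
      rewrite sumrB -!addrA; congr (_ + (_ + _)); apply/eqP; rewrite -subr_eq0 opprK.
      by rewrite -(bigD1 j) //= r0.
    by apply: cnorm_mean => // k _; case: ifP.
  - have -> : e - x = (M%:R^-1)%:C *: \sum_(k | k != i) (if k == j then e - r j else e).
      rewrite -[X in X - _]scM -scalerBr; congr (_ *: _).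
      rewrite -sumE (bigD1 j) //= [RHS](bigD1 j) //= eqxx.
      rewrite [in RHS](eq_bigr (fun k => e)); last by move=> k /andP[_ /negbTE->].
      by rewrite addrAC.
    by apply: cnorm_mean => // k _; case: ifP.
move=> x0; have rj0 : r j = 0.
  by rewrite -[r j]scM -scaler_nat !scalerA mulrC -scalerA -/x x0 scaler0.
have [sj jj] := pP j.
(* Here [r j] is [star (p j * p i) * (p j * p i)]. *)
have h : p j * p i = 0.
  by apply: star_mul_eq0; rewrite starM sj se mulrA -[p i * _ * _]mulrA jj.
by rewrite -se -sj -starM h star0.
Qed.

Section OrthogonalFamily.
Context (I : finType) (p : I -> B).
Hypotheses (pP : forall i, projection (p i)) (p1 : \sum_i p i = 1).

Lemma orthogonal_mull i (P : pred I) : p i * (\sum_(j | P j) p j) = p i *+ P i.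
Proof.
rewrite mulr_sumr big_mkcond (bigD1 i) //= (pP i).2 big1 ?addr0 -?mulrb //.
move=> j ji; case: ifP => // _.
by rewrite (projections_orthogonal pP p1) // eq_sym.
Qed.

Lemma orthogonal_mulr i (P : pred I) : (\sum_(j | P j) p j) * p i = p i *+ P i.
Proof.
rewrite mulr_suml big_mkcond (bigD1 i) //= (pP i).2 big1 ?addr0 -?mulrb //.
by move=> j ji; case: ifP => // _; rewrite (projections_orthogonal pP p1).
Qed.

Lemma orthogonal_sum_mul (P Q : pred I) :
  (\sum_(i | P i) p i) * (\sum_(i | Q i) p i) = \sum_(i | P i && Q i) p i.
Proof.
rewrite mulr_suml big_mkcondr /=; apply: eq_bigr => i _.
by rewrite orthogonal_mull mulrb.
Qed.

End OrthogonalFamily.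

End Orthogonality.

(** * Quantum automorphisms of a graph *)

Section QuantumAutomorphism.
Context (R : realType) (G : sgraph) (B : cstarAlgType R) (u : G -> G -> B).
Hypothesis uP : qut_relations u.
Implicit Types x y z w : G.

Lemma qut_projection x y : projection (u x y).
Proof. by split; [exact: qut_star uP x y | exact: qut_idem uP x y]. Qed.

Lemma qut_row_orthogonal x y w : y != w -> u x y * u x w = 0.
Proof.
exact: (projections_orthogonal (fun y => qut_projection x y) (qut_row uP x)).
Qed.

Lemma qut_col_orthogonal x z y : x != z -> u x y * u z y = 0.
Proof.
exact: (projections_orthogonal (fun x => qut_projection x y) (qut_col uP y)).
Qed.

Lemma qut_adjE x y : \sum_(w | edge w y) u x w = \sum_(z | edge x z) u z y.
Proof.
have := qut_adj uP x y; rewrite /adjmx => /esym.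
do 2![rewrite (eq_bigr _ (fun _ _ => scaler_nat _ _))
  (eq_bigr _ (fun _ _ => mulrb _ _)) -big_mkcond /=].
by [].
Qed.

Lemma qut_row_mull x y (P : pred G) :
  u x y * (\sum_(w | P w) u x w) = u x y *+ P y.
Proof. exact: (orthogonal_mull (qut_projection x) (qut_row uP x)). Qed.

Lemma qut_row_mulr x y (P : pred G) :
  (\sum_(w | P w) u x w) * u x y = u x y *+ P y.
Proof. exact: (orthogonal_mulr (qut_projection x) (qut_row uP x)). Qed.

Lemma qut_col_mulr x y (P : pred G) :
  (\sum_(z | P z) u z y) * u x y = u x y *+ P x.
Proof.
exact: (orthogonal_mulr (p := u^~ y) (qut_projection^~ y) (qut_col uP y)).
Qed.

Lemma qut_col_sum_mul y (P Q : pred G) :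
  (\sum_(x | P x) u x y) * (\sum_(x | Q x) u x y) = \sum_(x | P x && Q x) u x y.
Proof.
exact: (orthogonal_sum_mul (p := u^~ y) (qut_projection^~ y) (qut_col uP y)).
Qed.

(** Multiply [qut_adjE x w] by [u x y] on the left and [u z w] on the right. Row orthogonality
    leaves the product times the truth value of [edge y w] on one side, column orthogonality that of
    [edge x z] on the other. *)
Lemma qut_edge_orthogonal x y z w :
  edge x z != edge y w -> u x y * u z w = 0.
Proof.
move=> ne; have := congr1 (fun b => u x y * b * u z w) (qut_adjE x w).
rewrite qut_row_mull -mulrA qut_col_mulr.
by case: (edge x z) ne; case: (edge y w) => //= _; rewrite ?mulr0n ?mulr0 ?mul0r.
Qed.

Lemma qut_eq_orthogonal x y z w : (x == z) != (y == w) -> u x y * u z w = 0.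
Proof.
have [->|xz] := eqVneq x z; have [->|yw] := eqVneq y w => //= _.
  exact: qut_row_orthogonal.
exact: qut_col_orthogonal.
Qed.

Definition hub x z t := #|[pred s | [&& edge s x, edge s z & edge s t]]|.

(* Sandwich the product over the three rows of sum_(b ~ s) u_xb = sum_(r ~ x) u_rs
   and sum over the hub s: expanded in the columns it counts hubs of columns,
   expanded in the rows it counts hubs of rows. *)
Lemma qut_hub x1 x2 x3 y1 y3 :
  \sum_y2 u x1 y1 * u x2 y2 * u x3 y3 *+ hub y1 y2 y3 =
  u x1 y1 * u x3 y3 *+ hub x1 x2 x3.
Proof.
pose g x s := \sum_(w | edge s w) u x w.
have gE x s : g x s = \sum_(r | edge r x) u r s.
  rewrite /g (eq_bigl _ _ (fun r => edge_sym r x)) -qut_adjE.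
  exact: (eq_bigl _ _ (fun r => edge_sym s r)).
transitivity (u x1 y1 * (\sum_s g x1 s * g x2 s * g x3 s) * u x3 y3).
  rewrite mulr_sumr mulr_suml.
  rewrite [RHS](eq_bigr (fun s => \sum_y2
    u x1 y1 * u x2 y2 * u x3 y3 *+ [&& edge s y1, edge s y2 & edge s y3])).
    rewrite [RHS]exchange_big; apply: eq_bigr => y2 _.
    by rewrite sumrMnr /hub -sum1_card [X in _ *+ X = _]big_mkcond.
  move=> s _; rewrite !mulrA qut_row_mull -!mulrA qut_row_mulr.
  rewrite mulrnAl !mulrnAr -mulrnA mulr_suml mulr_sumr -sumrMnl big_mkcond /=.
  apply: eq_bigr => y2 _; rewrite mulrA.
  by case: (edge s y1); case: (edge s y2); case: (edge s y3).
(* In column [s] the three sums multiply to the sum of [u r s] over the common neighbours [r] of the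
   rows. Summing over [s] first then gives 1 for each such [r]. *)
rewrite (eq_bigr (fun s => \sum_(r | [&& edge r x1, edge r x2 & edge r x3]) u r s)).
  rewrite exchange_big (eq_bigr _ (fun r _ => qut_row uP r)) sumr_const.
  by rewrite mulr_natr mulrnAl.
by move=> s _; rewrite !gE !qut_col_sum_mul; apply: eq_bigl => r; rewrite andbA.
Qed.

End QuantumAutomorphism.

(** * Criteria for two projections to commute *)

Section CommutingProjections.
Context (R : realType) (B : cstarAlgType R).
Implicit Types p q r : B.

Lemma projections_comm_of_sandwich p q :
  projection p -> projection q -> p * q = p * q * p -> p * q = q * p.
Proof.
move=> [sp _] [sq _] h; have : star (p * q) = p * q.
  by rewrite h !starM sp sq mulrA.
by rewrite starM sp sq => ->.
Qed.

(** The relations make [q * p * q] idempotent. Hence [d = p * q - q * p * q] satisfies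
    [star d * d = 0], so [p * q] equals the self-adjoint [q * p * q]. *)
Lemma projections_comm_of_triangle p q r :
  projection p -> projection q -> projection r ->
  p * q = p * r * q -> p * r = p * q * r -> q * r = q * p * r ->
  p * q = q * p.
Proof.
move=> [sp pp] [sq qq] [sr rr] pq pr qr.
have qp : q * p = q * r * p by have := congr1 star pq; rewrite !starM sp sq sr mulrA.
have rq : r * q = r * p * q by have := congr1 star qr; rewrite !starM sp sq sr mulrA.
have qrq : q * r * q = q * p * q by rewrite -mulrA rq !mulrA -qp.
have aa : (q * p * q) * (q * p * q) = q * p * q.
  rewrite -{2}qrq; have -> : q * p * q * (q * r * q) = q * (p * q * r) * q.
    by rewrite !mulrA -(mulrA (q * p) q q) qq.
  by rewrite -pr mulrA -qr qrq.
have h : p * q - q * p * q = 0.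
  apply: star_mul_eq0; rewrite starD starN !starM sp sq mulrBl !mulrBr !mulrA.
  have -> : q * p * p * q = q * p * q by rewrite -(mulrA q) pp.
  have -> : q * p * q * p * q = q * p * q * (q * p * q).
    by rewrite !mulrA -(mulrA (q * p) q q) qq.
  have -> : q * p * q * q * p * q = q * p * q * (q * p * q) by rewrite !mulrA.
  by rewrite aa !subrr.
have pqE : p * q = q * p * q by apply/eqP; rewrite -subr_eq0 h.
have : star (p * q) = p * q by rewrite pqE !starM sp sq mulrA.
by rewrite starM sp sq => ->.
Qed.

End CommutingProjections.

(** * Kneser graphs *)

Section Triangles.
Context (n : nat).
Implicit Types x y z w s t : KG2 n.

Lemma KG2_card x : #|val x| = 2%N. Proof. exact: eqP (valP x). Qed.

Lemma KG2_edgeE x y : edge x y = [disjoint val x & val y]. Proof. by []. Qed.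

(** The relation # of the outline; [meets_cardI] recovers the single common point. *)
Definition meets x z := (x != z) && ~~ edge x z.

Lemma meets_sym x z : meets x z = meets z x.
Proof. by rewrite /meets eq_sym edge_sym. Qed.

Lemma KG2_subset x y : (val x \subset val y) = (x == y).
Proof.
rewrite -val_eqE; apply/idP/eqP => [h|-> //].
by apply/eqP; rewrite eqEcard h !KG2_card.
Qed.

Lemma meets_cardI x z : meets x z -> #|val x :&: val z| = 1%N.
Proof.
move=> /andP[xz]; rewrite KG2_edgeE -setI_eq0 -cards_eq0 -lt0n => I0.
apply/eqP; rewrite eqn_leq I0 andbT -ltnS -[X in (_ < X)%N](KG2_card x).
apply: proper_card; rewrite properEneq subsetIl andbT.
by apply: contraNneq xz => /setIidPl; rewrite KG2_subset.
Qed.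

Lemma meets_cardU x z : meets x z -> #|val x :|: val z| = 3%N.
Proof. by move=> /meets_cardI h; rewrite cardsU !KG2_card h. Qed.

(** Pairs are seen as edges on the points. Three distinct edges spanning only three points are the
    sides of a triangle; this form is symmetric in the three pairs, and the size of the union is
    what [hubKG2] needs. *)
Definition triangle x t z :=
  [&& x != t, x != z, t != z & #|val x :|: val t :|: val z| == 3%N].

Lemma triangle_swapl x t z : triangle x t z -> triangle t x z.
Proof.
by move=> /and4P[xt xz tz U3]; rewrite /triangle eq_sym xt tz xz (setUC (val t)).
Qed.

Lemma triangle_swapr x t z : triangle x t z -> triangle x z t.
Proof.
by move=> /and4P[xt xz tz U3]; rewrite /triangle xz xt eq_sym tz setUAC.
Qed.

Lemma triangle_meets x t z : triangle x t z -> meets x z.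
Proof.
move=> /and4P[_ xz _ /eqP U3]; rewrite /meets xz KG2_edgeE /=.
rewrite -setI_eq0; apply/negP => /eqP xz0.
have : (#|val x :|: val z| <= 3)%N.
  by rewrite -U3 subset_leq_card // setUAC subsetUl.
by rewrite cardsU xz0 cards0 !KG2_card.
Qed.

Lemma meets_triangle x z : meets x z -> exists t, triangle x t z.
Proof.
move=> xz; pose D := (val x :|: val z) :\: (val x :&: val z).
have D2 : #|D| == 2%N.
  rewrite cardsD meets_cardU // (setIidPr _) ?meets_cardI //.
  by rewrite (subset_trans (subsetIl _ _)) ?subsetUl.
(* The common point [a] of [x] and [z] lies outside [D], which separates [D] from both. *)
exists (Sub D D2); have [a aI] : exists a, a \in val x :&: val z.
  by apply/set0Pn; rewrite -card_gt0 meets_cardI.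
have aD : a \notin D by rewrite inE aI.
have [ax az] : a \in val x /\ a \in val z by apply/andP; rewrite -in_setI.
apply/and4P; split.
- by apply: contraNneq aD => xE; move: ax; rewrite xE.
- by case/andP: xz.
- by apply: contraNneq aD => zE; move: az; rewrite -zE.
- by rewrite SubK setUAC (setUidPl _) ?meets_cardU // subsetDl.
Qed.

(** The three points of [y] and [w] carry only three pairs, namely [y], [w] and [s]. So [b] has a
    point outside them; as it meets [y], it adds exactly one point. *)
Lemma card_not_triangle y s w b : triangle y s w -> meets y b -> meets b w ->
  b != s -> #|val y :|: val b :|: val w| = 4%N.
Proof.
move=> tri yb bw bs; have /and4P[ys yw sw U3] := tri.
pose U := val y :|: val w.
have U_3 : #|U| = 3%N by apply/meets_cardU/triangle_meets/tri.
have sU : val s \subset U.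
  apply/setUidPl/eqP; rewrite eq_sym eqEcard subsetUl U_3.
  by rewrite /U setUAC (eqP U3).
have bU : ~~ (val b \subset U).
  apply/negP => bU; pose L := [:: val y; val w; val s; val b].
  have uL : uniq L.
    rewrite /L /= !inE !negb_or !(inj_eq val_inj) yw ys (eq_sym w) sw (eq_sym s) bs.
    by move: yb bw => /andP[-> _] /andP[bw _]; rewrite eq_sym bw.
  have : (size L <= #|[set A : {set 'I_n} | A \subset U & #|A| == 2%N]|)%N.
    rewrite -(card_uniqP uL) subset_leq_card //; apply/subsetP => A.
    rewrite !inE => /or4P[] /eqP ->; rewrite KG2_card eqxx andbT //.
      exact: subsetUl.
    exact: subsetUr.
  by rewrite cards_draws U_3.
rewrite setUAC -/U cardsU U_3 KG2_card.
have : (0 < #|U :&: val b|)%N.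
  rewrite card_gt0; apply/set0Pn.
  have : (0 < #|val y :&: val b|)%N by rewrite meets_cardI.
  by move=> /card_gt0P[a]; rewrite !inE => /andP[ay ab]; exists a; rewrite !inE ay.
have : (#|U :&: val b| < 2)%N.
  by rewrite -[X in (_ < X)%N](KG2_card b) proper_card // properEneq subsetIr andbT; apply: contraNneq bU => /setIidPr.
by case: #|_| => [|[|]].
Qed.

Lemma hubKG2 x t z : hub x t z = 'C(n - #|val x :|: val t :|: val z|, 2)%N.
Proof.
have -> : (n - #|val x :|: val t :|: val z|)%N = #|~: (val x :|: val t :|: val z)|.
  by rewrite [RHS]cardsCs setCK card_ord.
rewrite -cards_draws /hub -(card_imset _ val_inj).
apply: eq_card => A; rewrite !inE; apply/imsetP/andP.
  move=> [s]; rewrite inE => /and3P[sx st sz] ->; rewrite KG2_card; split=> //.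
  by rewrite !setCU !subsetI -!disjoints_subset -andbA; apply/and3P.
move=> [AU A2]; exists (Sub A A2); last by rewrite SubK.
move: AU; rewrite !setCU !subsetI -!disjoints_subset -andbA => /and3P h.
by rewrite inE; apply/and3P; rewrite !KG2_edgeE SubK.
Qed.

End Triangles.

(** * Commutation of the generators *)

Section KneserCommutation.
Context (R : realType) (B : cstarAlgType R) (n : nat) (u : KG2 n -> KG2 n -> B).
Hypotheses (n_ge5 : (5 <= n)%N) (uP : qut_relations u).
Implicit Types x y z w s t p q : KG2 n.

Lemma qut_meets_orthogonal x y z w :
  meets x z != meets y w -> u x y * u z w = 0.
Proof.
move=> h; have [e|] := eqVneq (edge x z) (edge y w); last exact: qut_edge_orthogonal.
apply: qut_eq_orthogonal => //; apply: contraNneq h.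
by rewrite /meets e => ->.
Qed.

(** Let [Y] and [X] be the two sides. In [qut_hub], a middle column other than [s] contributes zero
    or has ['C(m, 2)] hubs, and these columns of row [t] sum to [1 - u t s]. What remains is
    [(Y - X) *+ m = 0]. *)
Lemma qut_triangle x t z y s w : triangle x t z -> triangle y s w ->
  u x y * u z w = u x y * u t s * u z w.
Proof.
move=> xtz ysw; pose m := (n - 4)%N.
have hub_triangle (a b c : KG2 n) : triangle a b c -> hub a b c = ('C(m, 2) + m)%N.
  move=> /and4P[_ _ _ /eqP abc]; rewrite hubKG2 abc.
  (* Pascal's rule, with [n - 3 = m + 1]. *)
  by rewrite -subnSK ?binS ?bin1 // ltnW.
have := qut_hub uP x t z y w.
rewrite (bigD1 s) //= (hub_triangle x t z) // (hub_triangle y s w) //.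
rewrite (eq_bigr (fun b => u x y * u t b * u z w *+ 'C(m, 2))); last first.
  move=> b bs; case: (boolP (meets y b)) => [yb|nyb]; last first.
    rewrite (@qut_meets_orthogonal x y t b) ?mul0r ?mul0rn //.
    by rewrite (negbTE nyb) (triangle_meets (triangle_swapr xtz)).
  case: (boolP (meets b w)) => [bw|nbw]; last first.
    rewrite -mulrA (@qut_meets_orthogonal t b z w) ?mulr0 ?mul0rn //.
    by rewrite (negbTE nbw) (triangle_meets (triangle_swapl xtz)).
  by rewrite hubKG2 (card_not_triangle ysw).
rewrite sumrMnl -mulr_suml -mulr_sumr.
have -> : \sum_(b | b != s) u t b = 1 - u t s.
  by rewrite -(qut_row uP t) [in RHS](bigD1 s) //= addrAC subrr add0r.
rewrite mulrBr mulr1 mulrBl !mulrnDr mulrnBl.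
set X := u x y * u t s * u z w; set Y := u x y * u z w => h.
have {h} : (Y - X) *+ m = 0.
  rewrite mulrnBl; apply/eqP; rewrite subr_eq0; apply/eqP.
  apply: (@addrI _ (Y *+ 'C(m, 2))); rewrite -h.
  by rewrite [LHS]addrC addrA addrNK.
rewrite -scaler_nat => /eqP; rewrite scaler_eq0 pnatr_eq0.
(* This is where [n >= 5] enters. *)
have -> : (m == 0)%N = false by rewrite subn_eq0 leqNgt n_ge5.
by rewrite subr_eq0 => /eqP.
Qed.

Lemma qut_meets_comm x y z w : meets x z -> meets y w ->
  u x y * u z w = u z w * u x y.
Proof.
move=> /meets_triangle[t xtz] /meets_triangle[s ysw].
apply: (projections_comm_of_triangle (r := u t s)); try exact: qut_projection.
- exact: qut_triangle.
- by apply: qut_triangle; apply: triangle_swapr.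
- by apply: qut_triangle; apply/triangle_swapl/triangle_swapr.
Qed.

(** Take [q = {a, c}] with [a] in [y] but not in [p], and [c] in [w]. Since [w] is disjoint from [y]
    and [p], [c] avoids both. *)
Lemma KG2_bridge y w p : edge y w -> edge w p -> y != p ->
  exists q, [/\ meets y q, meets q w & edge q p].
Proof.
rewrite !KG2_edgeE => yw wp yp.
have [a ay ap] : exists2 a, a \in val y & a \notin val p.
  by apply/subsetPn; rewrite KG2_subset.
have [c cw] : exists c, c \in val w by apply/card_gt0P; rewrite KG2_card.
have aw : a \notin val w by rewrite (disjointFr yw).
have cy : c \notin val y by rewrite (disjointFl yw).
have cp : c \notin val p by rewrite (disjointFr wp).
have ac2 : #|[set a; c]| == 2%N by rewrite cards2 (contraNneq _ cy) // => <-.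
exists (Sub [set a; c] ac2); split.
- rewrite /meets KG2_edgeE SubK; apply/andP; split.
    by apply: contraNneq cy => ->; rewrite SubK !inE eqxx orbT.
  by rewrite -setI_eq0; apply/set0Pn; exists a; rewrite !inE ay eqxx.
- rewrite /meets KG2_edgeE SubK; apply/andP; split.
    by apply: contraNneq aw => <-; rewrite SubK !inE eqxx.
  by rewrite -setI_eq0; apply/set0Pn; exists c; rewrite !inE cw eqxx orbT.
- by rewrite KG2_edgeE SubK disjoints_subset subUset !sub1set !inE ap cp.
Qed.

Lemma qut_edge_comm x y z w : edge x z -> edge y w ->
  u x y * u z w = u z w * u x y.
Proof.
move=> xz yw; apply: projections_comm_of_sandwich; try exact: qut_projection.
(* Expanding 1 along row [x] on the right leaves the wanted term [p = y]; every other term must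
   vanish. *)
rewrite -[LHS]mulr1 -(qut_row uP x) mulr_sumr (bigD1 y) //= big1 ?addr0 // => p py.
have [wp|wp] := boolP (edge w p); last first.
  rewrite -mulrA (qut_edge_orthogonal uP) ?mulr0 //.
  by rewrite edge_sym xz (negbTE wp).
have [q [yq qw qp]] := KG2_bridge yw wp (contra_neq esym py).
(* Column [q] is inserted after [u x y]; only rows [r] that meet both [x] and [z] survive. *)
rewrite -[u x y]mulr1 -(qut_col uP q) mulr_sumr !mulr_suml big1 // => r _.
have [xr|xr] := boolP (meets x r); last first.
  by rewrite (@qut_meets_orthogonal x y r q) ?mul0r // yq (negbTE xr).
have [rz|rz] := boolP (meets r z); last first.
  rewrite -[u x y * _ * _]mulrA (@qut_meets_orthogonal r q z w) ?mulr0 ?mul0r //.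
  by rewrite qw (negbTE rz).
(* Moving [u r q] past [u z w] brings it next to [u x p]. Their product is zero, because [r] meets
   [x] while [q] is disjoint from [p]. *)
rewrite -[u x y * _ * _]mulrA (qut_meets_comm rz qw) -!mulrA.
rewrite (@qut_meets_orthogonal r q x p) ?mulr0 //.
by rewrite meets_sym xr /meets qp andbF.
Qed.

Lemma qut_comm x y z w : u x y * u z w = u z w * u x y.
Proof.
have [m1|m1] := boolP (meets x z == meets y w); last first.
  by rewrite !qut_meets_orthogonal // meets_sym [meets w y]meets_sym.
have [e1|e1] := boolP (edge x z == edge y w); last first.
  by rewrite !(qut_edge_orthogonal uP) // edge_sym [edge w y]edge_sym.
case: (boolP (edge x z)) e1 m1 => [xz|xz] /eqP/esym yw.
  by move=> _; apply: qut_edge_comm.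
case: (boolP (meets x z)) => [m1|m1] /eqP/esym m2; first exact: qut_meets_comm.
(* The remaining case is [x = z] and [y = w]. *)
move: m1 m2; rewrite /meets xz yw /= !andbT negbK => /eqP -> /negbFE/eqP ->.
by [].
Qed.

End KneserCommutation.

(** * The C*-algebra C(Aut(G)) *)

HB.instance Definition _ (G : sgraph) :=
  Finite.copy (graph_aut G) {g : {perm G} | is_graph_aut g}.

Section ComplexNorm.
Context (R : realType).
Implicit Types z : R[i].

Lemma normcE z : (normc z)%:C = `|z|.
Proof. by rewrite normc_def; case: z. Qed.

Lemma normc_ge0 z : 0 <= normc z.
Proof. by rewrite -lecR normcE normr_ge0. Qed.

Lemma normcD z1 z2 : normc (z1 + z2) <= normc z1 + normc z2.
Proof. by rewrite -lecR rmorphD /= !normcE ler_normD. Qed.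

Lemma normc_conj_mul z : normc (z^*%R * z) = normc z ^+ 2.
Proof.
apply: complexI; rewrite normcE normrM norm_conjC rmorphXn /= normcE expr2.
by [].
Qed.

(** The limit is the supremum of the set [E] of eventual lower bounds of [s]. Once the tail
    oscillates by less than [e], this supremum lies within [e] of [s N]. *)
Lemma cauchy_real (s : nat -> R) :
  (forall e : R, 0 < e -> exists N : nat,
     forall m n, (N <= m)%N -> (N <= n)%N -> `|s m - s n| < e) ->
  exists l : R, forall e : R, 0 < e -> exists N : nat,
    forall n, (N <= n)%N -> `|s n - l| < e.
Proof.
move=> s_cauchy.
pose E : classical_sets.set R := fun x => exists N, forall n, (N <= n)%N -> x <= s n.
have close (e : R) N : (forall m n, (N <= m)%N -> (N <= n)%N -> `|s m - s n| < e) ->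
    E (s N - e) /\ classical_sets.ubound E (s N + e).
  move=> hN; split.
    by exists N => n Nn; have := hN N n (leqnn N) Nn; rewrite ltr_norml => /andP[_]; lra.
  move=> x [M hM]; have := hM (maxn M N) (leq_maxl _ _).
  have := hN (maxn M N) N (leq_maxr _ _) (leqnn N); rewrite ltr_norml => /andP[_]; lra.
have supE : classical_sets.has_sup E.
  have [N /close[EN ubN]] := s_cauchy 1 ltr01.
  by split; [exists (s N - 1) | exists (s N + 1)].
exists (sup E) => e e0; have e3 : 0 < e / 3%:R by rewrite divr_gt0.
have [N hN] := s_cauchy _ e3; have [EN ubN] := close _ _ hN; exists N => n Nn.
have h1 : s N - e / 3%:R <= sup E by exact: sup_upper_bound.
have h2 : sup E <= s N + e / 3%:R by apply: ge_sup => //; case: supE.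
have := hN n N Nn (leqnn N); rewrite !ltr_norml => /andP[h3 h4].
by apply/andP; split; lra.
Qed.

Lemma cauchy_complex (s : nat -> R[i]) :
  (forall e : R, 0 < e -> exists N : nat,
     forall m n, (N <= m)%N -> (N <= n)%N -> normc (s m - s n) < e) ->
  exists l : R[i], forall e : R, 0 < e -> exists N : nat,
    forall n, (N <= n)%N -> normc (s n - l) < e.
Proof.
move=> s_cauchy.
have le_Re z : `|complex.Re z| <= normc z.
  by case: z => a b; rewrite /= -sqrtr_sqr ler_wsqrtr // lerDl sqr_ge0.
have le_Im z : `|complex.Im z| <= normc z.
  by case: z => a b; rewrite /= -sqrtr_sqr ler_wsqrtr // lerDr sqr_ge0.
have [e e0|a ha] := @cauchy_real (fun n => complex.Re (s n)).
  have [N hN] := s_cauchy e e0; exists N => m n Nm Nn.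
  by rewrite -raddfB (le_lt_trans (le_Re _)) ?hN.
have [e e0|b hb] := @cauchy_real (fun n => complex.Im (s n)).
  have [N hN] := s_cauchy e e0; exists N => m n Nm Nn.
  by rewrite -raddfB (le_lt_trans (le_Im _)) ?hN.
exists (a +i* b) => e e0; have e2 : 0 < e / 2%:R by rewrite divr_gt0.
have [N1 h1] := ha _ e2; have [N2 h2] := hb _ e2; exists (maxn N1 N2) => n.
rewrite geq_max => /andP[/h1 + /h2]; case: (s n) => c d h3 h4.
have -> : (c +i* d) - (a +i* b) = (c - a)%:C + 'i * (d - b)%:C :> R[i] by simpc.
apply: le_lt_trans (normcD _ _) _.
rewrite ComplexField.Normc.normcM !normc_real /= expr0n add0r expr1n sqrtr1 mul1r.
by rewrite [e]splitr ltrD.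
Qed.

End ComplexNorm.

(** * The supremum norm on C(Aut(G)) *)

Section CAutCStar.
Context (R : realType) (G : sgraph).
Implicit Types (f h : CAut R G) (g : graph_aut G) (x y : G).

(** The starting value 0 does not change the maximum, since moduli are nonnegative. *)
Definition CAut_norm f : R := \big[Num.max/0]_(g : graph_aut G) normc (f g).

Lemma CAut_norm_ge f g : normc (f g) <= CAut_norm f.
Proof. exact: le_bigmax. Qed.

Lemma CAut_norm_ge0 f : 0 <= CAut_norm f.
Proof. exact: bigmax_ge_id. Qed.

Lemma CAut_norm_le f (c : R) :
  0 <= c -> (forall g, normc (f g) <= c) -> CAut_norm f <= c.
Proof. by move=> c0 fc; apply: bigmax_le. Qed.

Lemma CAut_norm0_eq0 f : CAut_norm f = 0 -> f = 0.
Proof.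
move=> f0; apply/funext => g; apply: ComplexField.Normc.eq0_normc.
by apply/eqP; rewrite eq_le normc_ge0 andbT -f0 CAut_norm_ge.
Qed.

Lemma CAut_normD f h : CAut_norm (f + h) <= CAut_norm f + CAut_norm h.
Proof.
apply: CAut_norm_le => [|g]; first by rewrite addr_ge0 ?CAut_norm_ge0.
by apply: le_trans (normcD _ _) _; rewrite lerD ?CAut_norm_ge.
Qed.

Lemma CAut_normZ (a : R[i]) f : CAut_norm (a *: f) = normc a * CAut_norm f.
Proof.
apply/eqP; rewrite eq_le; apply/andP; split.
  apply: CAut_norm_le => [|g]; first by rewrite mulr_ge0 ?CAut_norm_ge0 ?normc_ge0.
  rewrite [X in normc X]/(a * f g) ComplexField.Normc.normcM.
  by rewrite ler_wpM2l ?normc_ge0 ?CAut_norm_ge.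
have [->|an0] := eqVneq (normc a) 0; first by rewrite mul0r CAut_norm_ge0.
have a0 : 0 < normc a by rewrite lt0r an0 normc_ge0.
rewrite mulrC -ler_pdivlMr //; apply: CAut_norm_le => [|g].
  by rewrite divr_ge0 ?CAut_norm_ge0 ?ltW.
by rewrite ler_pdivlMr // mulrC -ComplexField.Normc.normcM CAut_norm_ge.
Qed.

Lemma CAut_normM f h : CAut_norm (f * h) <= CAut_norm f * CAut_norm h.
Proof.
apply: CAut_norm_le => [|g]; first by rewrite mulr_ge0 ?CAut_norm_ge0.
rewrite [X in normc X]/(f g * h g) ComplexField.Normc.normcM.
by rewrite ler_pM ?normc_ge0 ?CAut_norm_ge.
Qed.

Lemma CAut_norm_star_mul f : CAut_norm (star f * f) = CAut_norm f ^+ 2.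
Proof.
have sfE g : normc ((star f * f) g) = normc (f g) ^+ 2 by exact: normc_conj_mul.
apply/eqP; rewrite eq_le; apply/andP; split.
  apply: CAut_norm_le => [|g]; first exact: sqr_ge0.
  by rewrite sfE lerXn2r ?nnegrE ?normc_ge0 ?CAut_norm_ge0 ?CAut_norm_ge.
(* For the converse inequality, take square roots and bound each modulus separately. *)
rewrite -[leRHS]sqr_sqrtr ?CAut_norm_ge0 //.
rewrite lerXn2r ?nnegrE ?CAut_norm_ge0 ?sqrtr_ge0 //.
apply: CAut_norm_le => [|g]; first exact: sqrtr_ge0.
by rewrite -[normc _]ger0_norm ?normc_ge0 // -sqrtr_sqr ler_wsqrtr // -sfE CAut_norm_ge.
Qed.

Lemma CAut_norm_complete (s : nat -> CAut R G) :
  (forall e : R, 0 < e -> exists N : nat,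
     forall m n, (N <= m)%N -> (N <= n)%N -> CAut_norm (s m - s n) < e) ->
  exists l : CAut R G, forall e : R, 0 < e -> exists N : nat,
    forall n, (N <= n)%N -> CAut_norm (s n - l) < e.
Proof.
move=> s_cauchy.
have lim_g g : exists l : R[i], forall e : R, 0 < e -> exists N : nat,
    forall n, (N <= n)%N -> normc (s n g - l) < e.
  apply: cauchy_complex => e e0; have [N hN] := s_cauchy e e0.
  exists N => m n Nm Nn; apply: le_lt_trans (hN m n Nm Nn).
  exact: (CAut_norm_ge (s m - s n) g).
have [l hl] := choice lim_g; exists l => e e0.
have e2 : 0 < e / 2%:R by rewrite divr_gt0.
have [N hN] := choice (fun g => hl g _ e2).
(* Finiteness of the group gives a common rank. The bound [e / 2] restores strictness, as the
   maximum is only bounded weakly. *)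
exists (\max_g N g)%N => n Nn; apply: (@le_lt_trans _ _ (e / 2%:R)).
  apply: CAut_norm_le => [|g]; first exact: ltW.
  by apply/ltW/hN; apply: leq_trans Nn; exact: leq_bigmax.
by rewrite ltr_pdivrMr // mulr_natr mulr2n ltrDl.
Qed.

HB.instance Definition _ := StarAlgebra_isCStar.Build R (CAut R G)
  CAut_norm0_eq0 CAut_normD CAut_normZ CAut_normM CAut_norm_star_mul
  CAut_norm_complete.

End CAutCStar.

(** * Relations and generation in C(Aut(G)) *)

Section CAutRelations.
Context (R : realType) (G : sgraph).
Implicit Types (f h : CAut R G) (g k : graph_aut G) (x y z : G).

Lemma graph_aut_edge g x y : edge (val g x) (val g y) = edge x y.
Proof. by have /forallP/(_ x)/forallP/(_ y)/eqP := valP g. Qed.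

Lemma graph_aut_neq g k : g != k -> exists y, val g y != val k y.
Proof.
move=> gk; apply/existsP; apply: contraNT gk; rewrite negb_exists => /forallP h.
by apply/eqP/val_inj/permP => y; apply/eqP; move: (h y); rewrite negbK.
Qed.

Lemma CAut_mulE f h g : (f * h) g = f g * h g. Proof. by []. Qed.

Lemma CAut_scaleE (a : R[i]) f g : (a *: f) g = a * f g. Proof. by []. Qed.

Lemma CAut_evalsum (I : Type) (r : seq I) (P : pred I) (F : I -> CAut R G) g :
  (\sum_(i <- r | P i) F i) g = \sum_(i <- r | P i) F i g.
Proof. by apply: (big_morph (fun f : CAut R G => f g)). Qed.

Lemma CAut_evalprod (I : Type) (r : seq I) (P : pred I) (F : I -> CAut R G) g :
  (\prod_(i <- r | P i) F i) g = \prod_(i <- r | P i) F i g.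
Proof. by apply: (big_morph (fun f : CAut R G => f g)). Qed.

Lemma CAut_gen_relations : qut_relations (@CAut_gen R G).
Proof.
split.
- move=> x y; apply/funext => g; exact: rmorph_nat.
- move=> x y; apply/funext => g; rewrite CAut_mulE /CAut_gen.
  by case: eqP => _; rewrite ?mulr1 ?mulr0.
- move=> x; apply/funext => g; rewrite CAut_evalsum (bigD1 ((val g)^-1%g x)) //=.
  rewrite /CAut_gen permKV eqxx big1 ?addr0 // => y yx.
  by case: (x =P val g y) yx => // ->; rewrite permK eqxx.
- move=> y; apply/funext => g; rewrite CAut_evalsum (bigD1 (val g y)) //=.
  by rewrite /CAut_gen eqxx big1 ?addr0 // => x /negbTE->.
- move=> x y; apply/funext => g; rewrite !CAut_evalsum.
  (* Each side has one nonzero term, at [g y] and at the preimage of [x] under [g]; they agree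
     because [g] preserves edges. *)
  rewrite (bigD1 (val g y)) //= [RHS](bigD1 ((val g)^-1%g x)) //=.
  rewrite [in LHS]big1 ?[in RHS]big1 => [||z]; last first.
  - by move=> /negbTE h; rewrite CAut_scaleE /CAut_gen h mulr0.
  - move=> z zx; rewrite CAut_scaleE /CAut_gen.
    by case: (x =P val g z) zx => [->|_ _]; rewrite ?permK ?eqxx ?mulr0.
  rewrite !addr0 !CAut_scaleE /adjmx; congr (_ * _).
    by rewrite -(graph_aut_edge g _ y) permKV.
  by rewrite /CAut_gen permKV !eqxx.
Qed.

(** The product of the generators at [(g y, y)] over all [y] is the indicator function of [g]. *)
Lemma CAut_basis f :
  f = \sum_(g : graph_aut G) f g *: \prod_y CAut_gen R (val g y) y.
Proof.
apply/funext => k; rewrite CAut_evalsum (bigD1 k) //= [X in _ + X]big1 => [|g gk].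
  rewrite addr0 CAut_scaleE CAut_evalprod big1 ?mulr1 // => y _.
  by rewrite /CAut_gen eqxx.
have [y gy] := graph_aut_neq gk.
rewrite CAut_scaleE CAut_evalprod (bigD1 y) //= /CAut_gen (negbTE gy).
by rewrite mul0r mulr0.
Qed.

Lemma starHom_CAut_eq (B : starAlgType R) (F1 F2 : starHom (CAut R G) B) :
  (forall x y, F1 (CAut_gen R x y) = F2 (CAut_gen R x y)) -> F1 =1 F2.
Proof.
move=> eqF f; rewrite (CAut_basis f) !linear_sum; apply: eq_bigr => g _.
rewrite !linearZ !rmorph_prod /=; congr (_ *: _).
by apply: eq_bigr => y _; exact: eqF.
Qed.

End CAutRelations.

(** * Commuting generators factor through C(Aut(G)) *)

Section CAutLift.
Context (R : realType) (G : sgraph) (B : cstarAlgType R) (v : G -> G -> B).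
Hypotheses (vP : qut_relations v)
  (v_comm : forall x y z w, v x y * v z w = v z w * v x y).
Implicit Types (f h : CAut R G) (g k : graph_aut G) (x y z : G).

(** The candidate image of the indicator of [m]. Arbitrary maps are allowed because expanding a
    product of column sums produces all of them. *)
Definition map_idem (m : G -> G) : B := \prod_y v (m y) y.

Lemma map_idem_star m : star (map_idem m) = map_idem m.
Proof.
rewrite /map_idem; elim: (index_enum G) => [|y s IH]; first by rewrite big_nil star1.
rewrite big_cons starM IH (qut_star vP); symmetry.
by apply: commr_prod => z _; exact: v_comm.
Qed.

Lemma map_idem_mul_self m y : v (m y) y * map_idem m = map_idem m.
Proof.
rewrite /map_idem; have := mem_index_enum y.
elim: (index_enum G) => [//|z s IH]; rewrite inE big_cons mulrA.
have [->|_] /= := eqVneq y z; first by rewrite (qut_idem vP).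
by move=> /IH h; rewrite v_comm -mulrA h.
Qed.

Lemma map_idem_mul m x y : v x y * map_idem m = map_idem m *+ (x == m y).
Proof.
have [->|xm] := eqVneq; first exact: map_idem_mul_self.
by rewrite -(map_idem_mul_self m y) mulrA (qut_col_orthogonal vP) // mul0r.
Qed.

Lemma eq_map_idem m1 m2 : m1 =1 m2 -> map_idem m1 = map_idem m2.
Proof. by move=> e; apply: eq_bigr => y _; rewrite e. Qed.

(** Any two factors have a nonzero product, so the orthogonality relations force [m] to be injective
    and to preserve edges and non-edges. *)
Lemma map_idem_neq0 m : map_idem m != 0 -> exists g, val g =1 m.
Proof.
move=> m0.
have mulE y z : v (m y) y * v (m z) z != 0.
  by apply: contra_neq m0 => e; rewrite -(map_idem_mul_self m y)
    -(map_idem_mul_self m z) mulrA e mul0r.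
have m_inj : injective m.
  move=> y z myz; apply/eqP; apply: contraNT (mulE y z) => yz.
  by rewrite (qut_eq_orthogonal vP) // myz eqxx (negbTE yz).
have aut_m : is_graph_aut (perm m_inj).
  apply/forallP => y; apply/forallP => z; rewrite !permE.
  by apply: contraNT (mulE y z) => /(qut_edge_orthogonal vP) ->.
by exists (exist (@is_graph_aut G) (perm m_inj) aut_m) => y; rewrite permE.
Qed.

Lemma map_idem_orthogonal g k :
  map_idem (val g) * map_idem (val k) = map_idem (val k) *+ (g == k).
Proof.
have [<-|gk] := eqVneq g k.
  rewrite {1}/map_idem; elim: (index_enum G) => [|y s IH].
    by rewrite big_nil mul1r.
  by rewrite big_cons -mulrA IH map_idem_mul_self.
have [y gy] := graph_aut_neq gk.
have := map_idem_mul_self (val g) y => /(congr1 star).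
rewrite starM map_idem_star (qut_star vP) => <-.
by rewrite -mulrA map_idem_mul (negbTE gy) mulr0.
Qed.

(** Expand the product over [y] of the column sums, each equal to 1, into a sum over all maps; those
    that are not automorphisms contribute zero. *)
Lemma map_idem_sum : \sum_(g : graph_aut G) map_idem (val g) = 1.
Proof.
have : \sum_(m : {ffun G -> G}) map_idem m = 1.
  rewrite -(bigA_distr_bigA (fun y x => v x y)) big1 // => y _.
  exact: qut_col vP y.
(* Each term is rewritten as a sum over the automorphisms with underlying map [m], of which there is
   at most one. *)
move=> <-; rewrite [RHS](eq_bigr (fun m : {ffun G -> G} =>
  \sum_(g : graph_aut G | [ffun y => val g y] == m) map_idem (val g))) => [|m _].
  rewrite [RHS](exchange_big_dep predT) //=; apply: eq_bigr => g _.
  by rewrite (big_pred1 [ffun y => val g y]) // => m; rewrite /= eq_sym.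
have [m0|/map_idem_neq0[g gm]] := eqVneq (map_idem m) 0.
  rewrite big1 // => g /eqP gm; rewrite -m0; apply: eq_map_idem => y.
  by rewrite -gm ffunE.
rewrite (big_pred1 g) => [|k]; first by apply: eq_map_idem => y; rewrite gm.
apply/eqP/eqP => [km|->]; last by apply/ffunP => y; rewrite ffunE gm.
by apply/val_inj/permP => y; rewrite gm -km ffunE.
Qed.

Definition CAut_lift f : B := \sum_g f g *: map_idem (val g).

Lemma CAut_lift_gen x y : CAut_lift (CAut_gen R x y) = v x y.
Proof.
rewrite -[RHS]mulr1 -map_idem_sum mulr_sumr; apply: eq_bigr => g _.
by rewrite map_idem_mul -scaler_nat.
Qed.

Fact CAut_lift_linear : linear CAut_lift.
Proof.
move=> a f h; rewrite /CAut_lift scaler_sumr -big_split /=; apply: eq_bigr => g _.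
by rewrite scalerA -scalerDl.
Qed.

Fact CAut_lift_monoid_morphism : monoid_morphism CAut_lift.
Proof.
split.
  by rewrite -map_idem_sum; apply: eq_bigr => g _; exact: scale1r.
move=> f h; rewrite /CAut_lift mulr_suml; apply: eq_bigr => g _.
rewrite mulr_sumr (bigD1 g) //= big1 => [|k kg].
  by rewrite addr0 -scalerAl -scalerAr map_idem_orthogonal eqxx scalerA.
by rewrite -scalerAl -scalerAr map_idem_orthogonal eq_sym (negbTE kg) !scaler0.
Qed.

HB.instance Definition _ :=
  GRing.isLinear.Build R[i] (CAut R G) B _ CAut_lift CAut_lift_linear.
HB.instance Definition _ :=
  GRing.isMonoidMorphism.Build (CAut R G) B CAut_lift CAut_lift_monoid_morphism.

Lemma CAut_lift_star f : CAut_lift (star f) = star (CAut_lift f).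
Proof.
rewrite /CAut_lift (big_morph star (@starD _ _) (@star0 _ _)).
by apply: eq_bigr => g _; rewrite starZ map_idem_star.
Qed.

Lemma CAut_universal :
  exists F : starHom (CAut R G) B, forall x y, F (CAut_gen R x y) = v x y.
Proof. by exists (StarHom CAut_lift_star) => x y; exact: CAut_lift_gen. Qed.

End CAutLift.

(** * From commutativity to the absence of quantum symmetry *)

Section NoQuantumSymmetry.
Context (R : realType) (G : sgraph).

Lemma starHom_id (A : starAlgType R) : exists F : starHom A A, F =1 id.
Proof. by exists (@StarHom R A A idfun (fun=> erefl)). Qed.

Lemma starHom_comp (A B C : starAlgType R) (F : starHom B C) (H : starHom A B) :
  exists K : starHom A C, K =1 F \o H.
Proof.
have FH x : (F \o H) (star x) = star ((F \o H) x) by rewrite /= !starHomP.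
by exists (@StarHom R A C (F \o H) FH).
Qed.

(** C(Aut(G)) is itself a universal model, which settles existence. For any other model, the two
    universal properties give maps both ways, mutually inverse because each composite fixes the
    generators. *)
Lemma no_quantum_symmetry_comm :
  (forall (B : cstarAlgType R) (v : G -> G -> B), qut_relations v ->
     forall x y z w, v x y * v z w = v z w * v x y) ->
  no_quantum_symmetry R G.
Proof.
move=> commG.
have univ (B : cstarAlgType R) (v : G -> G -> B) (vP : qut_relations v) :=
  CAut_universal vP (commG B v vP).
split.
  exists (CAut R G : cstarAlgType R), (@CAut_gen R G); split.
  - exact: CAut_gen_relations.
  - exact: univ.
  - by move=> B F1 F2; exact: starHom_CAut_eq.
move=> A u [uP lift uniq].
have [p pu] := lift _ _ (CAut_gen_relations R G); have [q qg] := univ _ _ uP.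
exists p; split=> //; exists q.
  have [K KE] := starHom_comp q p; have [J JE] := starHom_id A.
  move=> a; rewrite -[LHS](KE a) -[RHS](JE a); apply: uniq => x y.
  by rewrite KE JE /= pu qg.
have [K KE] := starHom_comp p q; have [J JE] := starHom_id (CAut R G).
move=> f; rewrite -[LHS](KE f) -[RHS](JE f); apply: starHom_CAut_eq => x y.
by rewrite KE JE /= qg pu.
Qed.

End NoQuantumSymmetry.

Theorem corollary1p3 (R : realType) (n : nat) (hn : (5 <= n)%N) :
  no_quantum_symmetry R (KG2 n).
Proof. by apply: no_quantum_symmetry_comm => B v vP; exact: qut_comm. Qed.
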